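(* Let $G=(I,\lambda,V,(A_i)_{i\in I},J)$ be an anonymous game, $(W,\|\cdot\|_W)$ a normed vector space and $h:W\to\mathbb R$ a $K$-strongly convex function ($K>0$), satisfying the OMD structural assumptions listed in the context. Let $\beta_0>0$ be arbitrary and $\beta_n=\frac1n$ for $n\ge1$. Let $\Psi_0\in\mathcal A$, $\eta_0=\Psi_0\sharp\lambda$, let $\Phi_0:I\to W^*$ be measurable, and let $(\Phi_n,\Psi_n,\eta_n)_{n\ge0}$, with $\Psi_n\in\mathcal A$, be generated by the Online Mirror Descent procedure: for $n\ge 0$, $$\Phi_{n+1}(i)=\Phi_n(i)-\beta_n\,y(\Psi_n(i),\eta_n),\qquad \Psi_{n+1}(i)=Q_{A_i}(\Phi_{n+1}(i))\quad\text{for every } i\in I,\qquad \eta_{n+1}=\Psi_{n+1}\sharp\lambda.$$ Suppose: 1. $G$ satisfies conditions (i)–(v) listed in the context; 2. for every $i\in I$ the set $A_i$ is convex, and there exists $M>0$ such that for $\lambda$-a.e. $i\in I$, $\|a\|_W\le M$ for all $a\in A_i$, and $R(M):=\sup_{\|a\|_W\le M}|h(a)|<+\infty$; 3. the map $\Phi_0:I\to W^*$ is bounded; 4. the cost $J$ is monotone; 5. there exists $k>0$ such that for all $n\ge0$: $\|y(\Psi_n(i),\eta_n)\|_{W^*}\le k$ and $\|y(\Psi_n(i),\tilde\eta)\|_{W^*}\le k$ for $\lambda$-a.e. $i\in I$, where $\tilde\eta=\tilde\Psi\sharp\lambda\in\mathcal P_G(V)$ is the unique Nash equilibrium distribution.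 Then $\eta_n=\Psi_n\sharp\lambda$ converges to $\tilde\eta$ as $n\to\infty$.
   Context: For a measurable space $X$, $\mathcal P(X)$ denotes the set of probability measures on $X$. $I$ (the set of players) is a topological space with its Borel $\sigma$-field, $\lambda\in\mathcal P(I)$ is non-atomic, $V$ is a metric space with distance $d_V$ and its Borel $\sigma$-field, and $A_i\subset V$ is the action set of player $i\in I$. Admissible profiles: $\mathcal A=\{\Psi:I\to V \text{ measurable}: \Psi(i)\in A_i \text{ for } \lambda\text{-a.e. } i\in I\}$, two profiles being identified if they agree $\lambda$-a.e. $\Psi\sharp\lambda$ is the push-forward of $\lambda$ by $\Psi$. $\mathcal P_G(V)=\{\eta\in\mathcal P(V): \exists\,\Psi\in\mathcal A,\ \eta=\Psi\sharp\lambda\}$. The cost is a function $J:V\times\mathcal P_G(V)\to\mathbb R$ (extended as in (ii) below). The data $G=(I,\lambda,V,(A_i)_{i\in I},J)$ is called an anonymous game. Standing assumption: there exist $M_0>0$, $v_0\in V$ such that for $\lambda$-a.e. $i\in I$ and every $a\in A_i$, $d_V(v_0,a)<M_0$. Hence $\mathcal P_G(V)\subseteq\mathcal P_1(V)=\{\eta\in\mathcal P(V):\exists v\in V,\ \int_V d_V(v,a)\,d\eta(a)<+\infty\}$, endowed with the metric $d_1(\eta_1,\eta_2)=\sup\{\int_V f\,d(\eta_1-\eta_2): f:V\to\mathbb R \text{ 1-Lipschitz}\}$; convergence of measures is in this metric. $\mathrm{cov}$ denotes convex hull and the bar denotes closure in $(\mathcal P_1(V),d_1)$. Conditions (i)–(v):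 (i) the correspondence $A:I\to V$, $A(i)=A_i$, is compact valued and continuous, i.e. its graph $\{(i,a): a\in A_i\}$ is closed in $I\times V$ and for every open $U\subseteq V$ the set $\{i: A_i\cap U\neq\emptyset\}$ is open in $I$; (ii) there is an extension $J:V\times\overline{\mathrm{cov}(\mathcal P_G(V))}\to\mathbb R$ which is lower semi-continuous; (iii) $\mathrm{Min}:I\times\mathcal P_G(V)\to\mathbb R$, $\mathrm{Min}(i,\eta)=\min_{a\in A_i}J(a,\eta)$, is continuous; (iv) $\overline{\mathrm{cov}(\mathcal P_G(V))}$ is compact; (v) (Unique Minimiser condition) for every $\eta\in\overline{\mathrm{cov}(\mathcal P_G(V))}$ there is $I_\eta\subseteq I$ with $\lambda(I\setminus I_\eta)=0$ such that for all $i\in I_\eta$ there is exactly one $a\in A_i$ minimizing $J(\cdot,\eta)$ over $A_i$. $J$ is monotone if for all $\eta,\eta'\in\overline{\mathrm{cov}(\mathcal P_G(V))}$: $\int_V|J(a,\eta)|\,d\eta'(a)<+\infty$ and $\int_V\big(J(a,\eta)-J(a,\eta')\big)\,d(\eta-\eta')(a)\ge 0$. Nash equilibrium: a profile $\tilde\Psi\in\mathcal A$ such that $\tilde\Psi(i)\in\arg\min_{a\in A_i}J(a,\tilde\Psi\sharp\lambda)$ for $\lambda$-a.e. $i\in I$; $\tilde\Psi\sharp\lambda$ is then called a Nash equilibrium distribution. $h:W\to\mathbb R$ is $K$-strongly convex if $h(sa_1+(1-s)a_2)\le s h(a_1)+(1-s)h(a_2)-Ks(1-s)\|a_1-a_2\|_W^2$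 for all $a_1,a_2\in W$, $s\in[0,1]$. $W^*$ is the dual of $W$. For $A\subseteq W$ and $y\in W^*$, $Q_A(y)=\arg\max_{a\in A}\big(\langle y,a\rangle-h(a)\big)$. $v\in W^*$ is a subgradient at $a\in W$ of a convex function $F:W\to\mathbb R$ if $F(b)-F(a)\ge\langle v,b-a\rangle$ for all $b\in W$; $\partial F(a)$ is the set of subgradients at $a$. OMD structural assumptions: – $\bigcup_{i\in I}A_i\subseteq W\subseteq V$; – for every $i\in I$, $A_i$ is weakly closed in $W$, and $h$ is weakly lower semi-continuous and coercive, i.e. $h(a)/\|a\|_W\to+\infty$ as $\|a\|_W\to\infty$ (so that $Q_{A_i}$ is single valued); – for every $(a,\eta)\in W\times\mathcal P_G(V)$ the function $J(\cdot,\eta):W\to\mathbb R$ is convex and there exists a (chosen) subgradient $y(a,\eta)\in\partial_aJ(\cdot,\eta)(a)\subseteq W^*$. *)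

(* Defs.v *)
From HB Require Import structures.
From mathcomp Require Import all_boot all_order all_algebra.
From mathcomp Require Import all_classical all_reals all_analysis.
From mathcomp Require Import measurable_realfun.

Set Implicit Arguments.
Unset Strict Implicit.
Unset Printing Implicit Defensive.

Import Order.TTheory GRing.Theory Num.Theory.
Import numFieldNormedType.Exports.

Local Open Scope classical_set_scope.
Local Open Scope ring_scope.

(* Measurable types are pointed in the library; a space carrying a probability
   measure is nonempty, so this is no restriction. *)
#[short(type="pmetricType")]
HB.structure Definition PointedMetric (R : numDomainType) :=
  {M of Metric R M & Pointed M}.

Notation borel T := (g_sigma_algebraType (@open T)).

Definition non_atomic d (T : measurableType d) (R : realType)
    (mu : {measure set T -> \bar R}) :=
  forall B, measurable B -> (0 < mu B)%E ->
    exists C, [/\ measurable C, C `<=` B & (0 < mu C < mu B)%E].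

Definition argmin (T : Type) (R : realType) (D : set T) (f : T -> R) : set T :=
  [set a | D a /\ forall b, D b -> f a <= f b].

Definition argmax (T : Type) (R : realType) (D : set T) (f : T -> R) : set T :=
  [set a | D a /\ forall b, D b -> f b <= f a].

Section dual.
Context {R : realType} (W : normedModType R).

(* [R^o] is [R] as a normed module over itself, so [linear f] is the usual
   linearity of a functional. *)
Definition is_dual : {pred W -> R^o} :=
  mem [set f : W -> R^o | linear f /\ continuous f].

Record dual := Dual { dual_fun :> W -> R^o; _ : dual_fun \in is_dual }.

HB.instance Definition _ := [isSub for dual_fun].
HB.instance Definition _ := [Choice of dual by <:].

Fact is_dual_submod : submod_closed is_dual.
Proof.
split=> [|a f g].
  rewrite inE; split=> [k u v|]; last exact: cst_continuous.
  by rewrite /= scaler0 addr0.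
rewrite !inE => -[lf cf] [lg cg]; split.
  move=> k u v; rewrite !fctE lf lg !scalerDr addrACA.
  by congr (_ + _); congr (_ + _); rewrite !scalerA mulrC.
by move=> x; apply: cvgD; [apply: cvgZl_tmp; exact: cf|exact: cg].
Qed.

HB.instance Definition _ :=
  GRing.isSubmodClosed.Build R (W -> R^o) is_dual is_dual_submod.
HB.instance Definition _ := [SubChoice_isSubLmodule of dual by <:].

Implicit Types f g : dual.

Definition dual_norm f : R := sup [set `|f a| | a in [set a : W | `|a| <= 1]].

Lemma dual_linear f : linear f.
Proof. by case: f => f /=; rewrite inE => -[]. Qed.

Lemma dual_continuous f : continuous f.
Proof. by case: f => f /=; rewrite inE => -[]. Qed.

Lemma dual_has_sup f :
  has_sup [set `|f a| | a in [set a : W | `|a| <= 1]].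
Proof.
split; first by exists `|f 0|; exists 0 => //=; rewrite normr0.
have fl := dual_linear f.
pose fL : {linear W -> R^o} :=
  HB.pack (f : W -> R^o) (GRing.isLinear.Build _ _ _ _ (f : W -> R^o) fl).
have /(@linear_bounded_continuous _ _ _ fL)/(@bounded_funP _ _ _ fL) :
  continuous fL by exact: dual_continuous.
by move=> /(_ 1)[M fM]; exists M => _ [a a1 <-]; exact: fM.
Qed.

Lemma le_dual_norm f a : `|f a| <= dual_norm f * `|a|.
Proof.
have fZ k u : f (k *: u) = k * f u.
  have f0 : f 0 = 0.
    by have /eqP := dual_linear f 1 0 0; rewrite !scale1r addr0 -subr_eq0
      opprD addrA subrr sub0r oppr_eq0 => /eqP.
  by have := dual_linear f k u 0; rewrite !addr0 f0 addr0.
have [->|a0] := eqVneq a 0.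
  by have := fZ 0 0; rewrite scale0r mul0r => ->; rewrite !normr0 mulr0.
rewrite -ler_pdivrMr ?normr_gt0//.
have -> : `|f a| / `|a| = `|f (`|a|^-1 *: a)|.
  by rewrite fZ normrM normfV normr_id mulrC.
apply: ub_le_sup; first by have [] := dual_has_sup f.
exists (`|a|^-1 *: a) => //=.
by rewrite normrZ normfV normr_id mulVf// normr_eq0.
Qed.

Lemma dual_norm_le f M : (forall a, `|a| <= 1 -> `|f a| <= M) ->
  dual_norm f <= M.
Proof.
move=> fM; apply: ge_sup; first by have [] := dual_has_sup f.
by move=> _ [a a1 <-]; exact: fM.
Qed.

Fact dual_norm_ge0 f : 0 <= dual_norm f.
Proof.
apply: le_trans (normr_ge0 (f 0)) _; apply: ub_le_sup.
  by have [] := dual_has_sup f.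
by exists 0 => //=; rewrite normr0.
Qed.

Fact ler_dual_normD f g : dual_norm (f + g) <= dual_norm f + dual_norm g.
Proof.
apply: dual_norm_le => a a1; apply: le_trans (ler_normD _ _) _.
by apply: lerD; apply: ub_le_sup;
  [have [] := dual_has_sup f|exists a|have [] := dual_has_sup g|exists a].
Qed.

Fact dual_normZ_le (l : R) f : dual_norm (l *: f) <= `|l| * dual_norm f.
Proof.
apply: dual_norm_le => a a1; rewrite normrZ ler_wpM2l//.
by apply: ub_le_sup; [have [] := dual_has_sup f|exists a].
Qed.

Fact dual_normZ (l : R) f : dual_norm (l *: f) = `|l| * dual_norm f.
Proof.
apply/eqP; rewrite eq_le dual_normZ_le/=.
have [->|l0] := eqVneq l 0; first by rewrite normr0 mul0r dual_norm_ge0.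
rewrite -ler_pdivlMl ?normr_gt0// -normfV.
by apply: le_trans (dual_normZ_le _ _); rewrite scalerA mulVf// scale1r.
Qed.

Fact dual_norm0_eq0 f : dual_norm f = 0 -> f = 0.
Proof.
move=> f0; apply/val_inj/funext => a; apply/normr0_eq0/eqP.
by rewrite eq_le normr_ge0 andbT; have := le_dual_norm f a; rewrite f0 mul0r.
Qed.

HB.instance Definition _ := Lmodule_isNormed.Build R dual
  ler_dual_normD dual_normZ dual_norm0_eq0.

(* The coarsest topology for which every element of [dual] is continuous: the
   initial topology of the evaluation map into the product of copies of [R]
   indexed by [dual]. *)
Definition weak := initial_topology
  (fun (a : W) => (fun f : dual => f a) : {ptws dual -> R^o}).

End dual.

Section wasserstein.
Context {R : realType} {V : pmetricType R}.

Record P1 := MkP1 {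
  P1_prob :> probability (borel V) R ;
  P1_moment :
    exists v : V, (\int[P1_prob]_a (mdist v (a : V))%:E < +oo)%E }.

HB.instance Definition _ := gen_eqMixin P1.
HB.instance Definition _ := gen_choiceMixin P1.

Definition lip1 : set (V -> R) :=
  [set f | forall a b, `|f a - f b| <= mdist a b].

Definition d1 (eta1 eta2 : P1) : \bar R := ereal_sup
  [set (\int[eta1]_a (f a)%:E - \int[eta2]_a (f a)%:E)%E | f in lip1].

Lemma lip1_measurable f : lip1 f ->
  measurable_fun [set: borel V] (f : borel V -> R).
Proof.
move=> fL; have fc : continuous f.
  move=> a; apply/cvgrPdist_lt => /= e e0.
  apply/nbhs_ballP; exists e => //= b; rewrite ballEmdist /= => ab.
  exact: le_lt_trans (fL a b) ab.
apply: (measurability _ (RGenOpens.measurableE R)) => _ [_ [x [y ->]] <-].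
rewrite setTI; apply: sub_sigma_algebra.
by move/continuousP : fc; apply; exact: interval_open.
Qed.

Lemma lip1_mdist v : lip1 (mdist v).
Proof.
move=> a b; rewrite ler_norml; apply/andP; split.
  by rewrite lerBrDl lerBlDr metric_triangle.
by rewrite lerBlDr addrC (metric_sym a b) metric_triangle.
Qed.

Lemma lip1_integrable (eta : P1) f : lip1 f ->
  eta.-integrable [set: borel V] (EFin \o f).
Proof.
move=> fL; have [v fin_v] := P1_moment eta.
have dI : eta.-integrable [set: borel V] (EFin \o mdist v).
  apply/integrableP; split.
    by apply/measurable_EFinP; exact: lip1_measurable (lip1_mdist v).
  by under eq_integral do rewrite /= ger0_norm ?mdist_ge0//.
have cI : eta.-integrable [set: borel V] (EFin \o cst `|f v|).
  exact: finite_measure_integrable_cst.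
apply: (le_integrable _ _ _ (integrableD _ cI dI)) => //.
  by apply/measurable_EFinP; exact: lip1_measurable.
move=> a _ /=; rewrite lee_fin [leRHS]ger0_norm ?addr_ge0 ?mdist_ge0//.
have -> : f a = f v + (f a - f v) by rewrite addrC subrK.
by apply: le_trans (ler_normD _ _) _; apply: lerD => //; rewrite distrC; exact: fL.
Qed.

Lemma lip1_fin (eta : P1) f : lip1 f ->
  (\int[eta]_a (f a)%:E)%E \is a fin_num.
Proof.
by move=> fL; apply: integrable_fin_num => //; exact: lip1_integrable.
Qed.

Let d1_ball (eta : P1) (e : R) := [set eta' | (d1 eta eta' < e%:E)%E].

Let d1_ball_center (eta : P1) (e : R) : 0 < e -> d1_ball eta e eta.
Proof.
move=> e0; rewrite /d1_ball/=; apply: (@le_lt_trans _ _ 0%E).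
  by apply: ge_ereal_sup => _ [f fL <-]; rewrite subee// lip1_fin.
by rewrite lte_fin.
Qed.

Let d1_sym_le (eta1 eta2 : P1) : (d1 eta1 eta2 <= d1 eta2 eta1)%E.
Proof.
apply: ge_ereal_sup => _ [f fL <-]; apply: ereal_sup_ubound.
have nfL : lip1 (fun a => - f a).
  by move=> a b; rewrite -opprD normrN; exact: fL.
exists (fun a => - f a) => //.
have iN (eta : P1) :
    (\int[eta]_a (- f a)%:E = - \int[eta]_a (f a)%:E)%E.
  under eq_integral do rewrite EFinN.
  by rewrite integralN// integrable_add_def//; exact: lip1_integrable.
by rewrite !iN oppeK addeC.
Qed.

Let d1_ball_sym (eta1 eta2 : P1) (e : R) :
  d1_ball eta1 e eta2 -> d1_ball eta2 e eta1.
Proof. exact: le_lt_trans (d1_sym_le _ _). Qed.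

Let d1_ball_triangle (eta1 eta2 eta3 : P1) (e e' : R) :
  d1_ball eta1 e eta2 -> d1_ball eta2 e' eta3 ->
  d1_ball eta1 (e + e') eta3.
Proof.
rewrite /d1_ball/= => d12 d23.
apply: (@le_lt_trans _ _ (d1 eta1 eta2 + d1 eta2 eta3)%E); last first.
  by rewrite EFinD lteD.
apply: ge_ereal_sup => _ [f fL <-].
apply: (@le_trans _ _ ((\int[eta1]_a (f a)%:E - \int[eta2]_a (f a)%:E) +
    (\int[eta2]_a (f a)%:E - \int[eta3]_a (f a)%:E))%E).
  by rewrite addeA subeK// lip1_fin.
by apply: leeD; apply: ereal_sup_ubound; exists f.
Qed.

HB.instance Definition _ :=
  hasNbhs.Build P1 (nbhs_ (entourage_ d1_ball)).
HB.instance Definition _ := @Nbhs_isPseudoMetric.Build R P1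
  (entourage_ d1_ball) erefl d1_ball d1_ball_center d1_ball_sym
  d1_ball_triangle erefl.

Lemma P1_ballE (eta : P1) (e : R) :
  ball eta e = [set eta' | (d1 eta eta' < e%:E)%E].
Proof. by []. Qed.

End wasserstein.
Arguments P1 {R} V.

(* Elements of [probability] are functions on all subsets of [V], with
   unspecified values off the Borel sets: two measures are the same when they
   agree on Borel sets. [P1 V] is therefore only a pseudometric space, in which
   [d1 eta eta' = 0] plays the role of equality of measures. *)
Definition same_law {R : realType} {V : pmetricType R} (eta eta' : P1 V) :=
  forall B : set (borel V), measurable B -> eta B = eta' B.

Definition convex_hull {R : realType} {V : pmetricType R} (S : set (P1 V)) :
    set (P1 V) :=
  [set eta | exists (n : nat) (t : 'I_n -> R) (mu : 'I_n -> P1 V),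
    [/\ forall j, 0 <= t j, \sum_j t j = 1, forall j, S (mu j) &
      forall B : set (borel V), measurable B ->
        eta B = (\sum_j (t j)%:E * mu j B)%E]].

Section game.
Context {R : realType} {I : ptopologicalType} {V : pmetricType R}.
Variables (lambda : probability (borel I) R) (A : I -> set V).

Definition admissible (Psi : I -> V) :=
  measurable_fun [set: borel I] (Psi : borel I -> borel V) /\
  {ae lambda, forall i, A i (Psi i)}.

Definition law_of (Psi : I -> V) (eta : P1 V) :=
  forall B : set (borel V), measurable B ->
    eta B = pushforward lambda (Psi : borel I -> borel V) B.

Definition PG : set (P1 V) :=
  [set eta | exists2 Psi, admissible Psi & law_of Psi eta].

Definition PGbar : set (P1 V) := closure (convex_hull PG).

Definition bounded_actions :=
  exists (M0 : R) (v0 : V), 0 < M0 /\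
    {ae lambda, forall i, forall a, A i a -> mdist v0 a < M0}.

Definition continuous_compact_actions :=
  [/\ forall i, compact (A i),
      closed [set p : I * V | A p.1 p.2] &
      forall U : set V, open U -> open [set i | A i `&` U !=set0]].

(* The cost already extended from [V * PG] to [V * PGbar]; its values at other
   points of [V * P1 V] are never used. *)
Variable J : V * P1 V -> R.

(* Points outside a set are isolated in its [subspace] topology, so this is
   lower semicontinuity of the restriction of [J] to [V * PGbar]. *)
Definition cost_lsc :=
  lower_semicontinuous
    (fun p : subspace ([set: V] `*` PGbar) => (J p)%:E).

Definition min_cost_continuous :=
  exists Min : I * P1 V -> R,
    (forall i eta, PG eta ->
      exists2 a, argmin (A i) (fun b => J (b, eta)) a &
        Min (i, eta) = J (a, eta)) /\
    {within [set: I] `*` PG, continuous Min}.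

Definition unique_minimiser :=
  forall eta, PGbar eta ->
    {ae lambda, forall i, exists! a, argmin (A i) (fun b => J (b, eta)) a}.

Definition monotone_cost :=
  forall eta eta', PGbar eta -> PGbar eta' ->
    eta'.-integrable [set: borel V] (fun a => (J (a, eta))%:E) /\
    0 <= \int[eta]_a (J (a, eta) - J (a, eta'))
         - \int[eta']_a (J (a, eta) - J (a, eta')).

Definition nash_distribution (eta : P1 V) :=
  exists Psi, [/\ admissible Psi, law_of Psi eta &
    {ae lambda, forall i, argmin (A i) (fun a => J (a, eta)) (Psi i)}].

Definition unique_nash_distribution (eta : P1 V) :=
  nash_distribution eta /\
  forall eta', nash_distribution eta' -> same_law eta' eta.

End game.

Section mirror_descent.
Context {R : realType} {W : normedModType R}.

Definition strongly_convex (K : R) (h : W -> R) :=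
  forall (a1 a2 : W) (s : R), 0 <= s <= 1 ->
    h (s *: a1 + (1 - s) *: a2) <=
      s * h a1 + (1 - s) * h a2 - K * s * (1 - s) * `|a1 - a2| ^+ 2.

Definition coercive (h : W -> R) :=
  forall C : R, exists r : R, forall a : W, r < `|a| -> C < h a / `|a|.

Definition subgradient (F : W -> R) (a : W) : set (dual W) :=
  [set v | forall b, v (b - a) <= F b - F a].

Definition mirror (h : W -> R) (D : set W) (v : dual W) : set W :=
  argmax D (fun a => v a - h a).

Context {I : ptopologicalType} {V : pmetricType R}.
Variables (lambda : probability (borel I) R) (A : I -> set V).
Variables (J : V * P1 V -> R) (iota : W -> V) (h : W -> R).
Variable y : W -> P1 V -> dual W.

(* The inclusion of [W] in [V] is the injection [iota]; nothing relates the
   norm of [W] to the distance of [V]. *)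
Definition omd_structure :=
  [/\ injective iota /\ (forall i, A i `<=` range iota),
      forall i, closed (iota @^-1` A i : set (weak W)),
      lower_semicontinuous (fun a : weak W => (h a)%:E),
      coercive h &
      forall eta, PG lambda A eta ->
        convex_function [set: convex_lmodType W]
          (fun a => J (iota a, eta) : R^o) /\
        forall a, subgradient (fun b => J (iota b, eta)) a (y a eta)].

(* [Psi 0] takes values in the [A i], hence in [W], only almost everywhere: the
   update of [Phi] is required where [Psi n i] is in [W], which for [0 < n] is
   everywhere. *)
Definition omd_procedure (beta : nat -> R) (Phi : nat -> I -> dual W)
    (Psi : nat -> I -> V) (eta : nat -> P1 V) :=
  [/\ forall n, admissible lambda A (Psi n),
      forall n, law_of lambda (Psi n) (eta n),
      forall n i a, Psi n i = iota a ->
        Phi n.+1 i = Phi n i - beta n *: y a (eta n) &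
      forall n i, exists2 a, mirror h (iota @^-1` A i) (Phi n.+1 i) a &
        Psi n.+1 i = iota a].

End mirror_descent.

(* Main.v *)
Require Import Defs.
From HB Require Import structures.
From mathcomp Require Import all_boot all_order all_algebra.
From mathcomp Require Import all_classical all_reals all_analysis.
From mathcomp Require Import ring lra measurable_realfun.

Set Implicit Arguments.
Unset Strict Implicit.
Unset Printing Implicit Defensive.

Import Order.TTheory GRing.Theory Num.Theory.
Import numFieldNormedType.Exports.

Local Open Scope classical_set_scope.
Local Open Scope ring_scope.

(** Fix an equilibrium profile [PsiN] with distribution [etaN], and write
    [G n i] for [J (Psi n i, etaN) - J (PsiN i, etaN)], the amount by which
    player [i] misses the minimum of [J (_, etaN)] at time [n]. The proof shows
    that the mean of [G n] over the players tends to [0], and that this forces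
    [eta n] to converge to [etaN].

    For one player, mirror descent has bounded regret: the Fenchel coupling
    between the dual iterate and a fixed action is nonnegative and telescopes
    ([mirror_regret]), and by convexity of the cost its decrease at time [n] is
    at least [beta n * (J (Psi n i, eta n) - J (PsiN i, eta n))], up to a
    multiple of [beta n ^+ 2], which is summable ([player_regret]). The bound
    is uniform in the player. The coupling involves the vectors [y] and [Phi],
    whose measurability in [i] is unknown; it is therefore eliminated player by
    player, and only the resulting inequality between costs is integrated.
    Monotonicity of [J] allows [eta n] to be replaced by [etaN] in the
    integrated cost, so that the means [g n] of [G n] satisfy [\sum_n beta n *
    g n < +oo].

    As [\sum_n beta n] diverges, [g n] is small infinitely often. It is small
    eventually because it moves slowly: strong convexity of [h] makes one step
    of an iterate [O(beta n)] long ([mirror_lipschitz]) and subgradients make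
    the cost Lipschitz along it ([player_drift]), so [g n.+1 - g n] is
    [O(beta n)]; this is the situation of [cvg0_of_weighted_sum].

    Finally, if the means of the nonnegative functions [G n] tend to [0], then
    from every subsequence one extracts another along which [G n i] tends to
    [0] for almost every [i]. Since [A i] is compact, [J (_, etaN)] lower
    semicontinuous and its minimiser over [A i] unique, [Psi n i] tends to
    [PsiN i] ([cvg_unique_argmin]), and dominated convergence gives the
    convergence of the laws ([cvg_law_of_cost]). *)

(** * Slowly varying sequences with a convergent weighted sum *)

(** The increments of [g ^+ 2] are bounded by a multiple of
    [b n * g n + b n ^+ 2], hence summable, so [g ^+ 2] converges; a positive
    limit would make [\sum_n b n * g n] comparable to the divergent
    [\sum_n b n]. *)
Lemma cvg0_of_weighted_sum (R : realType) (g b : nat -> R) (C D S : R) :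
  (forall n, 0 <= g n) -> (forall n, 0 <= b n) ->
  (forall n, `|g n.+1 - g n| <= C * b n) ->
  (forall N, \sum_(0 <= n < N) b n ^+ 2 <= S) ->
  (forall N, \sum_(0 <= n < N) b n * g n <= D) ->
  ~ cvgn (series b) ->
  g n @[n --> \oo] --> 0.
Proof.
move=> g0 b0 gC bS gD b_dvg.
have C0 n : 0 <= C * b n by exact: le_trans (normr_ge0 _) (gC n).
pose c n := C * b n * (2 * g n + C * b n).
have c0 n : 0 <= c n by rewrite mulr_ge0// addr_ge0// mulr_ge0.
have dg2 n : `|g n.+1 ^+ 2 - g n ^+ 2| <= c n.
  rewrite subr_sqr normrM ler_pM//.
  rewrite ger0_norm ?addr_ge0//.
  by have := gC n; rewrite ler_norml => /andP[_]; lra.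
have cub N : series c N <= 2 * `|C| * D + C ^+ 2 * S.
  have -> : series c N = 2 * C * (\sum_(0 <= n < N) b n * g n) +
      C ^+ 2 * \sum_(0 <= n < N) b n ^+ 2.
    rewrite /series/= !mulr_sumr -big_split/=; apply: eq_bigr => n _.
    by rewrite /c; ring.
  have s0 : 0 <= \sum_(0 <= n < N) b n * g n.
    by apply: sumr_ge0 => n _; rewrite mulr_ge0.
  apply: lerD; last by rewrite ler_wpM2l// sqr_ge0.
  apply: (@le_trans _ _ (2 * `|C| * \sum_(0 <= n < N) b n * g n)).
    by rewrite ler_wpM2r// ler_wpM2l// ler_norm.
  by rewrite ler_wpM2l// mulr_ge0.
have c_cvg : cvgn (series c).
  apply: nondecreasing_is_cvgn.
    by apply/nondecreasing_seqP => n; rewrite /series/= big_nat_recr//= lerDl.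
  by exists (2 * `|C| * D + C ^+ 2 * S) => _ [N _ <-].
(* Subtracting the partial sums of a bound on the increments makes [g ^+ 2]
   nonincreasing. *)
have v_cvg : cvgn (fun n => g n ^+ 2 - series c n).
  apply: nonincreasing_is_cvgn.
    apply/nonincreasing_seqP => n; rewrite /series/= big_nat_recr//=.
    by have := dg2 n; rewrite ler_norml => /andP[_]; lra.
  exists (- (2 * `|C| * D + C ^+ 2 * S)) => _ [N _ <-].
  by rewrite lerBrDl (le_trans _ (sqr_ge0 _))// subr_le0.
have {v_cvg} g2_cvg : cvgn (fun n => g n ^+ 2).
  have -> : (fun n => g n ^+ 2) = (fun n => g n ^+ 2 - series c n) + series c.
    by apply/funext => n; rewrite fctE subrK.
  exact: is_cvgD.
set L := limn (fun n => g n ^+ 2) in g2_cvg *.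
have gL : g n ^+ 2 @[n --> \oo] --> L by exact: g2_cvg.
have L0 : 0 <= L.
  by apply: limr_ge => //; apply: nearW => n; rewrite sqr_ge0.
have [LE|Lneq] := eqVneq L 0.
  apply/cvgr0Pnorm_lt => e e0.
  have := gL; rewrite LE => /cvgr0Pnorm_lt/(_ _ (exprn_gt0 2 e0)).
  apply: filterS => n; rewrite normrX ltr_pXn2r// ?nnegrE// ltW//.
have {Lneq}Lgt0 : 0 < L by rewrite lt_neqAle eq_sym Lneq.
case: b_dvg; pose d := Num.sqrt (L / 2).
have d0 : 0 < d by rewrite sqrtr_gt0 divr_gt0.
have [N _ Nd] : \forall n \near \oo, d <= g n.
  have : \forall n \near \oo, L / 2 <= g n ^+ 2.
    by apply: (cvgr_ge L) => //; lra.
  apply: filterS => n; rewrite -(@ler_sqrt _ (L / 2)) ?sqr_ge0//.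
  by rewrite sqrtr_sqr ger0_norm.
have sb0 m n : 0 <= \sum_(m <= i < n) b i by apply: sumr_ge0.
apply: nondecreasing_is_cvgn.
  by apply/nondecreasing_seqP => n; rewrite /series/= big_nat_recr//= lerDl.
exists (series b N + D / d) => _ [n _ <-].
apply: (@le_trans _ _ (series b (maxn N n))).
  by rewrite /series/= [leRHS](@big_cat_nat _ _ _ n)//= ?leq_maxr// lerDl.
rewrite /series/= [leLHS](@big_cat_nat _ _ _ N)//= ?leq_maxl// lerD2l.
rewrite ler_pdivlMr// (le_trans _ (gD (maxn N n)))//.
rewrite [leRHS](@big_cat_nat _ _ _ N)//= ?leq_maxl// mulr_suml.
rewrite -[leLHS]add0r lerD//.
  by apply: sumr_ge0 => i _; rewrite mulr_ge0.
by apply: ler_sum_nat => i /andP[Ni _]; rewrite ler_wpM2l// Nd.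
Qed.

Lemma sum_harmonic_sqr_le2 (R : realType) N :
  \sum_(0 <= n < N) (@harmonic R n) ^+ 2 <= 2.
Proof.
(* The induction telescopes [(n + 1)^-2 <= n^-1 - (n + 1)^-1]. *)
suff : \sum_(0 <= n < N.+1) (@harmonic R n) ^+ 2 <= 2 - N.+1%:R^-1.
  rewrite big_nat_recr//= => H; apply: le_trans (le_trans _ H) _.
    by rewrite lerDl sqr_ge0.
  by rewrite gerBl invr_ge0.
elim: N => [|N IH].
  by rewrite big_nat1 /harmonic/= invr1 expr1n; lra.
rewrite big_nat_recr//=; apply: le_trans (lerD IH (lexx _)) _.
rewrite /harmonic/=.
set x : R := N.+1%:R; have x0 : 0 < x by rewrite ltr0n.
have -> : N.+2%:R = x + 1 :> R by rewrite /x -natr1.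
have -> : 2 - x^-1 + (x + 1)^-1 ^+ 2 = 2 - (x + 1)^-1 - (x * (x + 1) ^+ 2)^-1.
  by field; rewrite !gt_eqF//; lra.
by rewrite gerBl invr_ge0 mulr_ge0// ?sqr_ge0// ltW.
Qed.

(** * Mirror descent for a single player *)

Section DualAlgebra.
Context {R : realType} {W : normedModType R}.
Implicit Types (p g : dual W) (a b : W).

Lemma dualDr p a b : p (a + b) = p a + p b.
Proof. by have := dual_linear p 1 a b; rewrite !scale1r. Qed.

Lemma dualZr p (s : R) a : p (s *: a) = s * p a.
Proof.
have p0 : p 0 = 0 by apply: (addrI (p 0)); rewrite -dualDr !addr0.
by have := dual_linear p s a 0; rewrite p0 !addr0.
Qed.

Lemma dualBr p a b : p (a - b) = p a - p b.
Proof. by rewrite dualDr -scaleN1r dualZr mulN1r. Qed.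

Lemma dualBZl p g (s : R) a : (p - s *: g) a = p a - s * g a.
Proof. by []. Qed.

Lemma ler_dual p a (k : R) : `|p| <= k -> `|p a| <= k * `|a|.
Proof.
by move=> pk; apply: le_trans (le_dual_norm p a) _; rewrite ler_wpM2r.
Qed.

End DualAlgebra.

Section MirrorSteps.
Context {R : realType} {W : normedModType R}.
Variables (h : W -> R) (K : R) (D : set W).
Hypotheses (K_gt0 : 0 < K) (h_sc : strongly_convex K h)
  (D_cvx : convex_set (D : set (convex_lmodType W))).
Implicit Types (p g : dual W) (a b w : W).

(** Comparing the maximiser [a] with the midpoint of [a] and [b] gives half of
    the modulus [K] that points tending to [a] would give in the limit. *)
Lemma mirror_gap p a b : mirror h D p a -> D b ->
  p b - h b <= p a - h a - K / 2 * `|b - a| ^+ 2.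
Proof.
move=> [Da amax] Db.
have h01 : (0 <= 2^-1 :> R) && (2^-1 <= 1 :> R) by lra.
have := D_cvx (Itv01 (andP h01).1 (andP h01).2) (mem_set Db) (mem_set Da).
move=> /set_mem /amax; have := h_sc b a h01.
rewrite /conv/= dualDr !dualZr.
by rewrite /unstable.onem; set ha := h (_ + _); lra.
Qed.

(** Each of the two maximisers beats the other one by the strong convexity gap
    for its own functional; in the sum of the two inequalities [h] cancels and
    only the difference [b *: g] of the functionals remains. *)
Lemma mirror_lipschitz p g a a' (b k : R) : 0 <= b -> `|g| <= k ->
  mirror h D p a -> mirror h D (p - b *: g) a' -> `|a' - a| <= b * k / K.
Proof.
move=> b0 gk pa pa'.
have [->|d0] := eqVneq (`|a' - a|) 0.
  by rewrite divr_ge0 ?(ltW K_gt0)// mulr_ge0//; apply: le_trans gk.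
have {}d0 : 0 < `|a' - a| by rewrite lt_neqAle eq_sym d0 /=.
have := mirror_gap pa pa'.1; have := mirror_gap pa' pa.1.
rewrite !dualBZl (distrC a a').
have := ler_dual (a' - a) gk; rewrite dualBr ler_norml => /andP[+ _].
set d := `|_| in d0 *; move=> gd ga' ga.
rewrite ler_pdivlMr// -(ler_pM2l d0).
by have := ler_wpM2l b0 gd; lra.
Qed.

(** When [a] maximises [p - h] over [D], this is the Fenchel coupling
    [h w + h^* p - p w], with [h^*] the convex conjugate of [h] on [D]. *)
Definition coupling p a w := p a - h a - (p w - h w).

(** The loss [b * (k * d)] due to the displacement [d] of the iterate is
    absorbed by the strong convexity gap, at the price of a square in [b]. *)
Lemma coupling_step p g a a' w (b k : R) : 0 <= b -> `|g| <= k ->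
  mirror h D p a -> mirror h D (p - b *: g) a' ->
  b * g (a - w) + coupling (p - b *: g) a' w <=
  coupling p a w + b ^+ 2 * (k ^+ 2 / (2 * K)).
Proof.
move=> b0 gk pa pa'; have := mirror_gap pa pa'.1.
have := ler_dual (a' - a) gk; rewrite dualBr ler_norml => /andP[+ _].
rewrite /coupling !dualBZl dualBr; set d := `|_| => gd ga.
have -> : b ^+ 2 * (k ^+ 2 / (2 * K)) =
    b * (k * d) - K / 2 * d ^+ 2 + K / 2 * (d - b * k / K) ^+ 2.
  by field; rewrite gt_eqF.
have : 0 <= K / 2 * (d - b * k / K) ^+ 2.
  by rewrite mulr_ge0 ?sqr_ge0 ?divr_ge0 ?ltW.
by have := ler_wpM2l b0 gd; lra.
Qed.

(** The coupling telescopes along the iterates and stays nonnegative. *)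
Lemma mirror_regret (p g : nat -> dual W) (a : nat -> W) w (b : nat -> R)
    (k : R) N :
  (forall n, 0 <= b n) -> (forall n, `|g n| <= k) ->
  (forall n, p n.+1 = p n - b n *: g n) ->
  (forall n, mirror h D (p n) (a n)) -> D w ->
  \sum_(0 <= n < N) b n * g n (a n - w) <=
    coupling (p 0%N) (a 0%N) w +
    (\sum_(0 <= n < N) b n ^+ 2) * (k ^+ 2 / (2 * K)).
Proof.
move=> b0 gk pS pa Dw.
suff : \sum_(0 <= n < N) b n * g n (a n - w) + coupling (p N) (a N) w <=
    coupling (p 0%N) (a 0%N) w +
    (\sum_(0 <= n < N) b n ^+ 2) * (k ^+ 2 / (2 * K)).
  by apply: le_trans; rewrite lerDl subr_ge0; exact: (pa N).2.
elim: N => [|N IH]; first by rewrite !big_nil mul0r add0r addr0.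
rewrite !big_nat_recr//= mulrDl.
have := pa N.+1; rewrite pS => paS.
by have := coupling_step w (b0 N) (gk N) (pa N) paS; lra.
Qed.

End MirrorSteps.

(** * Minimising sequences with a unique limit *)

(** A point [b] of [C] other than [a] has a neighborhood on which [f] exceeds
    some value above [f a]; [x] eventually leaves it. By compactness [x]
    eventually avoids all points of [C] outside a given neighborhood of [a]
    at once. *)
Lemma cvg_unique_argmin (T : topologicalType) (R : realType) (C : set T)
    (f : T -> R) (x : nat -> T) (a : T) :
  compact C -> lower_semicontinuous (fun b => (f b)%:E) ->
  (forall b, argmin C f b -> b = a) -> argmin C f a ->
  (forall n, C (x n)) -> f (x n) @[n --> \oo] --> f a ->
  x n @[n --> \oo] --> a.
Proof.
move=> /compact_near_coveringP cC flsc a_uniq [Ca amin] Cx fx U Ua.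
have near_cover : \forall n \near \oo, C `<=` [set b | x n = b -> U b].
  apply: cC => b Cb; have [->|ba] := pselect (b = a).
    exists (U, setT) => [|[b' n] [/= Ub' _] _//].
    by split => //; exact: filterT.
  have fab : f a < f b.
    rewrite ltNge; apply/negP => fba; apply: ba; apply: a_uniq.
    by split => // c Cc; apply: le_trans fba (amin _ Cc).
  have [Z nZ Zc] : exists2 Z, nbhs b Z &
      forall b', Z b' -> (((f a + f b) / 2)%:E < (f b')%:E)%E.
    by apply: flsc; rewrite lte_fin; lra.
  exists (Z, [set n | f (x n) < (f a + f b) / 2]) => /=.
    by split => //; apply: (cvgr_lt _ fx); lra.
  by move=> [b' n] [/= /Zc + fxn] xn; rewrite lte_fin -xn ltNge ltW.
by apply: filterS near_cover => n Cn; exact: (Cn _ (Cx n) erefl).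
Qed.

Lemma lsc_section (X Y : topologicalType) (R : realType) (f : X * Y -> R)
    (B : set Y) (b : Y) : B b ->
  lower_semicontinuous
    (fun p : subspace ([set: X] `*` B) => (f p)%:E) ->
  lower_semicontinuous (fun a : X => (f (a, b))%:E).
Proof.
move=> Bb flsc a c fc.
have [Z nZ Zc] := flsc (a, b) c fc.
exists [set a' | Z (a', b)]; last by move=> a' /Zc.
move: nZ; rewrite /nbhs/= -nbhs_subspace_in//= => -[[P Q] [/= Pa Qb] PQ].
apply: filterS Pa => a' Pa'; apply: (PQ (a', b)) => //=; split => //.
exact: nbhs_singleton.
Qed.

(** * Integration and almost everywhere convergence *)

Section Integration.
Context d (T : measurableType d) (R : realType).
Variable mu : {measure set T -> \bar R}.

Lemma ae_imp (P Q : T -> Prop) : (forall x, P x -> Q x) ->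
  {ae mu, forall x, P x} -> {ae mu, forall x, Q x}.
Proof. by move=> PQ; apply: filterS. Qed.

Lemma ae_and (P Q : T -> Prop) : {ae mu, forall x, P x} ->
  {ae mu, forall x, Q x} -> {ae mu, forall x, P x /\ Q x}.
Proof. exact: filterI. Qed.

(** The difference [g - f] agrees almost everywhere with its absolute value,
    whose integral is nonnegative. *)
Lemma ae_le_Rintegral (f g : T -> R) :
  mu.-integrable setT (EFin \o f) -> mu.-integrable setT (EFin \o g) ->
  {ae mu, forall x, f x <= g x} ->
  \int[mu]_x f x <= \int[mu]_x g x.
Proof.
move=> fi gi fg; rewrite -subr_ge0 -RintegralB//.
have mgf : measurable_fun setT (fun x => g x - f x).
  by apply: measurable_funB; apply/measurable_EFinP;
    [exact: (measurable_int mu gi)|exact: (measurable_int mu fi)].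
suff -> : \int[mu]_x (g x - f x) = \int[mu]_x `|g x - f x|.
  by apply: Rintegral_ge0.
congr fine; apply: ae_eq_integral => //.
- exact/measurable_EFinP.
- by apply/measurable_EFinP; exact: measurableT_comp.
- by apply: filterS fg => x fgx _; rewrite ger0_norm// subr_ge0.
Qed.

(** The series of the [`|f n|] has a finite integral, so it converges almost
    everywhere and its terms tend to [0]. *)
Lemma ae_cvg0_of_summable (f : nat -> T -> R) :
  (forall n, measurable_fun setT (f n)) ->
  (\sum_(0 <= n <oo) \int[mu]_x (`|f n x|)%:E < +oo)%E ->
  {ae mu, forall x, f n x @[n --> \oo] --> 0}.
Proof.
move=> mf foo.
have mnf n : measurable_fun setT (fun x => (`|f n x|)%:E).
  by apply/measurable_EFinP; exact: measurableT_comp.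
pose F x := (\sum_(0 <= n <oo) (`|f n x|)%:E)%E.
have iF : mu.-integrable setT F.
  apply/integrableP; split.
    exact: (@ge0_emeasurable_sum _ _ _ setT (fun n x => (`|f n x|)%:E) xpredT).
  under eq_integral do rewrite gee0_abs ?nneseries_ge0//.
  by rewrite integral_nneseries.
apply: filterS (integrable_ae measurableT iF) => x /(_ I) Fx.
apply: norm_cvg0; apply: cvg_series_cvg_0.
apply: nondecreasing_is_cvgn.
  by apply/nondecreasing_seqP => n; rewrite /series/= big_nat_recr//= lerDl.
exists (fine (F x)) => _ [n _ <-].
rewrite -lee_fin fineK// /series/= -sumEFin.
exact: nneseries_lim_ge.
Qed.

End Integration.

Section Means.
Context d (T : measurableType d) (R : realType).

Lemma integrable_Rsum (mu : {measure set T -> \bar R}) (f : nat -> T -> R) N :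
  (forall n, mu.-integrable setT (EFin \o f n)) ->
  mu.-integrable setT (EFin \o (fun x => \sum_(0 <= n < N) f n x)).
Proof.
move=> fi; have -> : EFin \o (fun x => \sum_(0 <= n < N) f n x) =
    (fun x => \sum_(0 <= n < N) (f n x)%:E)%E.
  by apply/funext => x; rewrite /= sumEFin.
apply: (@integrable_sum _ _ _ mu _ measurableT _ _ xpredT
  (fun n x => (f n x)%:E)) => n _; exact: fi.
Qed.

Lemma Rintegral_sum (mu : {measure set T -> \bar R}) (f : nat -> T -> R) N :
  (forall n, mu.-integrable setT (EFin \o f n)) ->
  \int[mu]_x (\sum_(0 <= n < N) f n x) = \sum_(0 <= n < N) \int[mu]_x f n x.
Proof.
move=> fi; elim: N => [|N IH].
  under eq_Rintegral do rewrite big_nil.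
  by rewrite Rintegral_cst// mul0r big_nil.
rewrite big_nat_recr//= -IH -RintegralD//; last exact: integrable_Rsum.
by apply: eq_Rintegral => x _; rewrite big_nat_recr.
Qed.

Lemma ae_le_mean (P : probability T R) (f : T -> R) (c : R) :
  P.-integrable setT (EFin \o f) -> {ae P, forall x, f x <= c} ->
  \int[P]_x f x <= c.
Proof.
move=> fi fc; have -> : c = \int[P]_x (cst c x).
  by rewrite Rintegral_cst// [X in fine X](probability_setT P) mulr1.
by apply: ae_le_Rintegral => //; exact: finite_measure_integrable_cst.
Qed.

Lemma ae_dist_mean_le (P : probability T R) (f g : T -> R) (c : R) :
  P.-integrable setT (EFin \o f) -> P.-integrable setT (EFin \o g) ->
  {ae P, forall x, `|f x - g x| <= c} ->
  `|\int[P]_x f x - \int[P]_x g x| <= c.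
Proof.
move=> fi gi fgc; rewrite ler_norml; apply/andP; split.
  rewrite lerNl opprB -RintegralB//; apply: ae_le_mean.
    exact: (integrableB measurableT gi fi).
  by apply: ae_imp fgc => x; rewrite distrC; exact: le_trans (ler_norm _).
rewrite -RintegralB//; apply: ae_le_mean.
  exact: (integrableB measurableT fi gi).
by apply: ae_imp fgc => x; exact: le_trans (ler_norm _).
Qed.

End Means.

(** * From convergence of costs to convergence of laws *)

Section Laws.
Context {R : realType} {I : ptopologicalType} {V : pmetricType R}.
Variables (lambda : probability (borel I) R) (A : I -> set V).

Section Transfer.
Variables (Psi : I -> V) (eta : P1 V) (f : V -> R).
Hypotheses (mPsi : measurable_fun [set: borel I] (Psi : borel I -> borel V))
  (PsiE : law_of lambda Psi eta)
  (fi : eta.-integrable [set: borel V] (EFin \o f)).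

Lemma law_integrable :
  lambda.-integrable [set: borel I] (fun i => (f (Psi i))%:E).
Proof.
have mf := measurable_int _ fi.
apply/integrableP; split.
  exact: (measurableT_comp mf mPsi).
have /integrableP[_] := fi; apply: le_lt_trans.
rewrite (eq_measure_integral (pushforward lambda (Psi : borel I -> borel V)));
  last by move=> B mB _; exact: PsiE.
rewrite ge0_integral_pushforward//.
exact: measurableT_comp.
Qed.

Lemma law_integral :
  (\int[eta]_a (f a)%:E = \int[lambda]_i (f (Psi i))%:E)%E.
Proof.
rewrite (eq_measure_integral (pushforward lambda (Psi : borel I -> borel V)));
  last by move=> B mB _; exact: PsiE.
rewrite integral_pushforward//.
  exact: measurable_int fi.
exact: law_integrable.
Qed.

Lemma law_Rintegral : \int[eta]_a f a = \int[lambda]_i f (Psi i).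
Proof. by rewrite /Rintegral law_integral. Qed.

End Transfer.

(** If [eta] were [e]-far from [eta'] infinitely often, there would be such
    times [s j] with summable excess costs, so that [Psi (s j) i] would tend
    to [Psi' i] for almost every [i]. The distance between [Psi (s j) i]
    and [Psi' i] need not be measurable in [i] when [V] is not separable; the
    contradiction comes from integrating instead the measurable
    [f j (Psi' i) - f j (Psi (s j) i)], which that distance dominates, where
    the 1-Lipschitz [f j] witnesses the distance of the laws. *)
Lemma cvg_law_of_cost (F : V -> R) (Psi : nat -> I -> V) (eta : nat -> P1 V)
    (Psi' : I -> V) (eta' : P1 V) :
  bounded_actions lambda A -> (forall i, compact (A i)) ->
  (forall n, admissible lambda A (Psi n)) ->
  (forall n, law_of lambda (Psi n) (eta n)) ->
  admissible lambda A Psi' -> law_of lambda Psi' eta' ->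
  lower_semicontinuous (fun a => (F a)%:E) ->
  {ae lambda, forall i, argmin (A i) F (Psi' i)} ->
  {ae lambda, forall i, exists! a, argmin (A i) F a} ->
  (forall n, (eta n).-integrable [set: borel V] (EFin \o F)) ->
  eta'.-integrable [set: borel V] (EFin \o F) ->
  \int[eta n]_a F a @[n --> \oo] --> \int[eta']_a F a ->
  eta n @[n --> \oo] --> eta'.
Proof.
move=> [M0 [v0 [M0_gt0 bA]]] cA aPsi PsiE aPsi' Psi'E Flsc Fmin Funiq
  Fi Fi' F_cvg.
have mPsi n := (aPsi n).1; have mPsi' := aPsi'.1.
have Gi n := law_integrable (mPsi n) (PsiE n) (Fi n).
have Gi' := law_integrable mPsi' Psi'E Fi'.
pose G n i := F (Psi n i) - F (Psi' i).
have iG n : lambda.-integrable [set: borel I] (EFin \o G n).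
  exact: (integrableB measurableT (Gi n) Gi').
have mG n : measurable_fun [set: borel I] (G n).
  by apply/measurable_EFinP; exact: measurable_int (iG n).
have absG n : (\int[lambda]_i (`|G n i|)%:E =
    (\int[eta n]_a F a - \int[eta']_a F a)%:E)%E.
  rewrite (law_Rintegral (mPsi n) (PsiE n) (Fi n)).
  rewrite (law_Rintegral mPsi' Psi'E Fi') -RintegralB//; last exact: Gi.
  transitivity (\int[lambda]_i (G n i)%:E)%E; last first.
    exact: esym (fineK (integrable_fin_num measurableT (iG n))).
  apply: ae_eq_integral => //.
  - by apply/measurable_EFinP; exact: measurableT_comp.
  - exact/measurable_EFinP.
  - apply: ae_imp (ae_and Fmin (aPsi n).2) => i [[_ imin] An] _ /=.
    by rewrite ger0_norm// subr_ge0 imin.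
apply/cvg_ballP => e e0; apply: contrapT => eta_far.
have far j : exists nf : nat * (V -> R),
    [/\ lip1 nf.2,
        \int[eta nf.1]_a F a - \int[eta']_a F a <= 1 / (2 ^ j.+1)%:R &
        ((e / 2)%:E < \int[eta']_a (nf.2 a)%:E -
                      \int[eta nf.1]_a (nf.2 a)%:E)%E].
  have Fj : \forall n \near \oo,
      \int[eta n]_a F a - \int[eta']_a F a <= 1 / (2 ^ j.+1)%:R.
    have pj : 0 < 1 / (2 ^ j.+1)%:R :> R by rewrite divr_gt0// ltr0n expn_gt0.
    apply: filterS (cvgr_le _ F_cvg (\int[eta']_a F a + 1 / (2 ^ j.+1)%:R) _).
      by move=> n; lra.
    by rewrite ltrDl.
  apply: contrapT => /forallNP noN; apply: eta_far.
  apply: filterS Fj => n Fn; rewrite P1_ballE/=.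
  apply: contrapT => /negP; rewrite -leNgt => e_le.
  have /ereal_sup_gt[_ [f fL <-] ef] : ((e / 2)%:E < d1 eta' (eta n))%E.
    by apply: lt_le_trans e_le; rewrite lte_fin; lra.
  by apply: (noN (n, f)).
have [nf nfP] := choice far.
pose s j := (nf j).1; pose f j := (nf j).2.
have fL j : lip1 (f j) by have [] := nfP j.
have Gs0 : {ae lambda, forall i, G (s j) i @[j --> \oo] --> 0}.
  apply: ae_cvg0_of_summable => //.
  apply: (@le_lt_trans _ _ (\sum_(0 <= j <oo) (0 + (1 / (2 ^ j.+1)%:R)%:E))%E).
    apply: lee_nneseries => [j _ _|j _]; first exact: integral_ge0.
    by rewrite absG add0e lee_fin; have [] := nfP j.
  apply: le_lt_trans (@epsilon_trick R (fun=> 0%E) 1 xpredT _ _) _ => //.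
  by rewrite eseries0// add0e ltry.
pose u j i := f j (Psi' i) - f j (Psi (s j) i).
have fi j (eta0 : P1 V) := lip1_integrable eta0 (fL j).
have fPi j := law_integrable (mPsi (s j)) (PsiE (s j)) (fi j (eta (s j))).
have fPi' j := law_integrable mPsi' Psi'E (fi j eta').
have iu j : lambda.-integrable [set: borel I] (EFin \o u j).
  exact: (integrableB measurableT (fPi' j) (fPi j)).
have u_mdist j i : `|u j i| <= mdist (Psi' i) (Psi (s j) i) by exact: fL.
have u_cvg : {ae lambda, forall i, setT i ->
    (u j i)%:E @[j --> \oo] --> (0 : \bar R)%E}.
  have aPsiA := ae_foralln (fun n => (aPsi n).2).
  apply: ae_imp (ae_and (ae_and Fmin Funiq) (ae_and aPsiA Gs0)).
  move=> i [[imin [a [_ a_uniq]]] [Ai Gi0]] _.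
  apply: cvg_EFin; first exact: nearW.
  have x_cvg : Psi (s j) i @[j --> \oo] --> Psi' i.
    apply: (cvg_unique_argmin (cA i) Flsc) => // [b /a_uniq <-|].
      by rewrite (a_uniq _ imin).
    by apply/subr_cvg0; exact: Gi0.
  apply/cvgr0Pnorm_lt => r r0.
  have x_near : \forall j \near \oo, mdist (Psi' i) (Psi (s j) i) < r.
    by have := cvg_ball x_cvg r0; rewrite ballEmdist; apply.
  by apply: filterS x_near => j; exact: le_lt_trans (u_mdist j i).
(* Almost all action sets lie in the ball of radius [M0] around [v0]. *)
have u_bounded : {ae lambda, forall i j, setT i ->
    (`|(u j i)%:E| <= (2 * M0)%:E)%E}.
  have aPsiA := ae_foralln (fun n => (aPsi n).2).
  apply: ae_imp (ae_and bA (ae_and aPsi'.2 aPsiA)) => i [bi [A'i Ai]] j _ /=.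
  rewrite lee_fin (le_trans (u_mdist j i))//.
  rewrite (le_trans (metric_triangle _ v0 _))// mulr2n mulrDl mul1r.
  by apply: lerD; apply: ltW; [rewrite metric_sym|]; exact: bi.
have iM : lambda.-integrable [set: borel I] (EFin \o cst (2 * M0)).
  exact: finite_measure_integrable_cst.
have [_ _] := dominated_convergence measurableT
  (fun j => measurable_int _ (iu j)) (measurable_cst (0 : \bar R)%E) u_cvg iM
  u_bounded.
rewrite integral0 => /fine_cvgP[_] /cvgr0Pnorm_lt /(_ (e / 2)).
have e2 : 0 < e / 2 by rewrite divr_gt0.
move=> /(_ e2)[j _ /(_ j (leqnn j))]/=.
apply/negP; rewrite -leNgt; apply: ltW.
have [_ _] := nfP j; rewrite -/(f j) -/(s j).
rewrite (law_integral mPsi' Psi'E (fi j _)).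
rewrite (law_integral (mPsi (s j)) (PsiE (s j)) (fi j _)).
rewrite -integralB//= => uj.
rewrite -lte_fin; apply: (lt_le_trans uj).
rewrite -[leLHS](fineK (integrable_fin_num measurableT (iu j))) lee_fin.
exact: ler_norm.
Qed.

End Laws.

(** * Online mirror descent in the game *)

Lemma PG_PGbar (R : realType) (I : ptopologicalType) (V : pmetricType R)
    (lambda : probability (borel I) R) (A : I -> set V) (eta : P1 V) :
  PG lambda A eta -> PGbar lambda A eta.
Proof.
move=> Geta; apply: subset_closure.
exists 1%N, (fun=> 1), (fun=> eta); split => //; first by rewrite big_ord1.
by move=> B mB; rewrite big_ord1/= mul1e.
Qed.

Section Players.
Context {R : realType} {I : ptopologicalType} {V : pmetricType R}
  {W : normedModType R}.
Variables (lambda : probability (borel I) R) (A : I -> set V)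
  (J : V * P1 V -> R) (iota : W -> V) (h : W -> R) (K : R)
  (y : W -> P1 V -> dual W) (beta : nat -> R)
  (Phi : nat -> I -> dual W) (Psi : nat -> I -> V) (eta : nat -> P1 V).
Hypotheses (K_gt0 : 0 < K) (h_sc : strongly_convex K h)
  (omd : omd_structure lambda A J iota h y)
  (beta0_gt0 : 0 < beta 0%N)
  (betaE : forall n, (1 <= n)%N -> beta n = n%:R^-1)
  (procedure : omd_procedure lambda A iota h y beta Phi Psi eta)
  (A_convex : forall i, convex_set (iota @^-1` A i : set (convex_lmodType W))).

Lemma cost_le_linear (nu : P1 V) a b : PG lambda A nu ->
  J (iota a, nu) - J (iota b, nu) <= y a nu (a - b).
Proof.
case: omd => _ _ _ _ J_sub /J_sub[_ /(_ a b)].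
by rewrite /= !dualBr; lra.
Qed.

Lemma iterate_PG n : PG lambda A (eta n).
Proof.
by case: procedure => adm law _ _; exists (Psi n).
Qed.

Section Player.
Variables (i : I) (k : R) (x : nat -> W).
Hypotheses (xE : forall n, Psi n i = iota (x n))
  (y_le : forall n, `|y (x n) (eta n)| <= k).

Let PhiS n : Phi n.+1 i = Phi n i - beta n *: y (x n) (eta n).
Proof. by case: procedure => _ _ + _; exact. Qed.

Lemma iterate_mirror n :
  mirror h (iota @^-1` A i) (Phi n.+1 i) (x n.+1).
Proof.
case: procedure => _ _ _ /(_ n i)[a amir].
by rewrite xE; case: omd => -[iota_inj _] _ _ _ _ /iota_inj ->.
Qed.

Lemma betaS n : beta n.+1 = harmonic n.
Proof. exact: betaE. Qed.

(** The sum starts at time 1, the first at which the action is a mirror image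
    of the dual iterate; the first dual step, of length at most
    [beta 0 * k], enters the bound on the initial coupling. *)
Lemma player_regret (M H C : R) w N :
  (forall a, A i (iota a) -> `|a| <= M) ->
  (forall a, `|a| <= M -> `|h a| <= H) ->
  `|Phi 0%N i| <= C -> A i (iota w) ->
  \sum_(0 <= n < N) harmonic n *
      (J (Psi n.+1 i, eta n.+1) - J (iota w, eta n.+1)) <=
  (C + beta 0%N * k) * (2 * M) + 2 * H + 2 * (k ^+ 2 / (2 * K)).
Proof.
move=> A_le h_le Phi0_le Aw.
have b0 n : 0 <= harmonic n :> R by rewrite harmonic_ge0.
have Phi_next n :
    Phi n.+2 i = Phi n.+1 i - harmonic n *: y (x n.+1) (eta n.+1).
  by rewrite PhiS betaS.
apply: (@le_trans _ _ (\sum_(0 <= n < N) harmonic n *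
    y (x n.+1) (eta n.+1) (x n.+1 - w))).
  apply: ler_sum => n _; rewrite ler_wpM2l// xE.
  by apply: cost_le_linear; exact: iterate_PG.
apply: le_trans (mirror_regret K_gt0 h_sc (@A_convex i) N
  b0 (fun n => y_le n.+1) Phi_next iterate_mirror Aw) _.
apply: lerD; last first.
  rewrite ler_wpM2r ?sum_harmonic_sqr_le2//.
  by rewrite divr_ge0 ?sqr_ge0// mulr_ge0// ltW.
have x1_le := A_le _ (iterate_mirror 0).1.
have w_le := A_le _ Aw.
have p_le : `|Phi 1%N i| <= C + beta 0%N * k.
  rewrite PhiS; apply: le_trans (ler_normB _ _) _; apply: lerD => //.
  by rewrite normrZ gtr0_norm// ler_wpM2l// ltW.
have := ler_dual (x 1%N - w) p_le; rewrite dualBr ler_norml => /andP[_ pxw].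
have xw_le : (C + beta 0%N * k) * `|x 1%N - w| <=
    (C + beta 0%N * k) * (2 * M).
  rewrite ler_wpM2l// ?(le_trans _ p_le)//.
  by apply: le_trans (ler_normB _ _) _; lra.
have := h_le _ x1_le; have := h_le _ w_le; rewrite !ler_norml.
by rewrite /coupling; move=> /andP[? ?] /andP[? ?]; lra.
Qed.

(** The subgradients at both ends of a step bound the change of cost in either
    direction by [k] times the length of the step. *)
Lemma player_drift (nu : P1 V) n : PG lambda A nu ->
  (forall n, `|y (x n) nu| <= k) ->
  `|J (Psi n.+2 i, nu) - J (Psi n.+1 i, nu)| <= k ^+ 2 / K * harmonic n.
Proof.
move=> Gnu ynu_le; rewrite !xE.
have k0 : 0 <= k by exact: le_trans (ynu_le 0%N).
have d_le : `|x n.+2 - x n.+1| <= harmonic n * k / K.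
  rewrite -betaS; apply: (mirror_lipschitz K_gt0 h_sc (@A_convex i) _
    (y_le n.+1) (iterate_mirror n)); first by rewrite betaS harmonic_ge0.
  by rewrite -PhiS; exact: iterate_mirror.
have -> : k ^+ 2 / K * harmonic n = k * (harmonic n * k / K) by ring.
have step a b : `|y a nu| <= k -> `|a - b| <= harmonic n * k / K ->
    J (iota a, nu) - J (iota b, nu) <= k * (harmonic n * k / K).
  move=> ya ab; apply: le_trans (cost_le_linear a b Gnu) _.
  apply: le_trans (ler_norm _) _; apply: le_trans (ler_dual _ ya) _.
  by rewrite ler_wpM2l.
rewrite ler_norml lerNl opprB; apply/andP; split; apply: step => //.
by rewrite distrC.
Qed.

End Player.
End Players.

Lemma bounded_of_ereal_sup (R : realType) (T : Type) (B : set T) (f : T -> R) :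
  (ereal_sup [set `|f a|%:E | a in B] < +oo)%E ->
  exists H : R, forall a, B a -> `|f a| <= H.
Proof.
move=> sup_lt; exists (fine (ereal_sup [set `|f a|%:E | a in B])) => a Ba.
have a_le : (`|f a|%:E <= ereal_sup [set `|f a|%:E | a in B])%E.
  by apply: ereal_sup_ubound; exists a.
rewrite -lee_fin fineK// fin_numElt sup_lt andbT.
by apply: lt_le_trans a_le; rewrite ltNyr.
Qed.

Theorem theorem4p1 (R : realType) (I : ptopologicalType) (V : pmetricType R)
  (lambda : probability (borel I) R) (A : I -> set V) (J : V * P1 V -> R)
  (W : normedModType R) (iota : W -> V) (h : W -> R) (K : R)
  (y : W -> P1 V -> dual W) (beta : nat -> R)
  (Phi : nat -> I -> dual W) (Psi : nat -> I -> V) (eta : nat -> P1 V)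
  (etaN : P1 V)
  (lambda_non_atomic : non_atomic lambda)
  (A_bounded : bounded_actions lambda A)
  (K_gt0 : 0 < K) (h_strongly_convex : strongly_convex K h)
  (omd : omd_structure lambda A J iota h y)
  (beta0_gt0 : 0 < beta 0%N)
  (betaE : forall n, (1 <= n)%N -> beta n = n%:R^-1)
  (Phi0_measurable :
    measurable_fun [set: borel I] (Phi 0%N : borel I -> borel (dual W)))
  (procedure : omd_procedure lambda A iota h y beta Phi Psi eta)
  (cond_i : continuous_compact_actions A)
  (cond_ii : cost_lsc lambda A J)
  (cond_iii : min_cost_continuous lambda A J)
  (cond_iv : compact (PGbar lambda A))
  (cond_v : unique_minimiser lambda A J)
  (A_convex : forall i, convex_set (iota @^-1` A i : set (convex_lmodType W)))
  (A_norm_bounded : exists M : R, [/\ 0 < M,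
    {ae lambda, forall i, forall a, A i (iota a) -> `|a| <= M} &
    (ereal_sup [set `|h a|%:E | a in [set a | (`|a| <= M)%R]] < +oo)%E])
  (Phi0_bounded : exists C : R, forall i, `|Phi 0%N i| <= C)
  (J_monotone : monotone_cost lambda A J)
  (etaN_nash : unique_nash_distribution lambda A J etaN)
  (y_bounded : exists k : R, 0 < k /\ forall n,
    {ae lambda, forall i, forall a, Psi n i = iota a -> `|y a (eta n)| <= k} /\
    {ae lambda, forall i, forall a, Psi n i = iota a -> `|y a etaN| <= k}) :
  eta n @[n --> \oo] --> etaN.
Proof.
case: A_norm_bounded => M [M_gt0 A_le /bounded_of_ereal_sup[H h_le]].
case: Phi0_bounded => C Phi0_le; case: y_bounded => k [k_gt0 y_le].
case: etaN_nash => -[PsiN [aPsiN PsiNE PsiN_min] _].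
have [aPsi PsiE _ _] := procedure.
have GN : PG lambda A etaN by exists PsiN.
have Geta n : PG lambda A (eta n) by exists (Psi n).
have J_int nu nu' : PG lambda A nu -> PG lambda A nu' ->
    nu'.-integrable [set: borel V] (EFin \o (fun a => J (a, nu))).
  by move=> /PG_PGbar Gnu /PG_PGbar Gnu'; have [] := J_monotone _ _ Gnu Gnu'.
have JPsi_int n nu (Gnu : PG lambda A nu) :=
  law_integrable (aPsi n).1 (PsiE n) (J_int _ _ Gnu (Geta n)).
have JPsiN_int nu (Gnu : PG lambda A nu) :=
  law_integrable aPsiN.1 PsiNE (J_int _ _ Gnu GN).
have meanPsi n nu (Gnu : PG lambda A nu) :=
  law_Rintegral (aPsi n).1 (PsiE n) (J_int _ _ Gnu (Geta n)).
have meanPsiN nu (Gnu : PG lambda A nu) :=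
  law_Rintegral aPsiN.1 PsiNE (J_int _ _ Gnu GN).
have player : {ae lambda, forall i, exists x : nat -> W,
    [/\ forall n, Psi n i = iota (x n),
        forall n, `|y (x n) (eta n)| <= k,
        forall n, `|y (x n) etaN| <= k,
        exists2 w, PsiN i = iota w & A i (iota w) &
        forall a, A i (iota a) -> `|a| <= M]}.
  have ae_y := ae_foralln (fun n => (y_le n).1).
  have ae_yN := ae_foralln (fun n => (y_le n).2).
  have ae_Psi := ae_foralln (fun n => (aPsi n).2).
  apply: ae_imp (ae_and (ae_and ae_y ae_yN)
    (ae_and ae_Psi (ae_and aPsiN.2 A_le))).
  move=> i [[yi yNi] [Ai [ANi Ai_le]]].
  have [[_ A_iota] _ _ _ _] := omd.
  have /choice[x xE] n : exists a, Psi n i = iota a.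
    by have [a _ <-] := A_iota i _ (Ai n); exists a.
  exists x; split => // [n|n|]; [exact: yi|exact: yNi|].
  by have [w _ wE] := A_iota i _ ANi; exists w; rewrite wE.
(* Times are shifted by one, so that [beta n.+1 = harmonic n]. *)
pose g n := \int[eta n.+1]_a J (a, etaN) - \int[etaN]_a J (a, etaN).
have g_ge0 n : 0 <= g n.
  rewrite subr_ge0 meanPsi// meanPsiN//; apply: ae_le_Rintegral.
  - exact: JPsiN_int.
  - exact: JPsi_int.
  - by apply: ae_imp (ae_and PsiN_min (aPsi n.+1).2) => i [[_ imin] Ai];
      exact: imin.
have g_drift n : `|g n.+1 - g n| <= k ^+ 2 / K * harmonic n.
  rewrite /g opprB addrA subrK !meanPsi//.
  apply: ae_dist_mean_le; [exact: JPsi_int|exact: JPsi_int|].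
  apply: ae_imp player => i [x [xE y_eta y_etaN _ _]].
  exact: (player_drift K_gt0 h_strongly_convex omd betaE procedure A_convex xE
    y_eta n GN y_etaN).
pose regret n i := harmonic n *
  (J (Psi n.+1 i, eta n.+1) - J (PsiN i, eta n.+1)).
have gap_int n := integrableB measurableT
  (JPsi_int n.+1 _ (Geta n.+1)) (JPsiN_int _ (Geta n.+1)).
have regret_int n : lambda.-integrable [set: borel I] (EFin \o regret n).
  exact: (integrableZl measurableT (harmonic n) (gap_int n)).
have g_regret n : harmonic n * g n <= \int[lambda]_i regret n i.
  rewrite RintegralZl//; last exact: gap_int.
  rewrite ler_wpM2l ?harmonic_ge0// RintegralB//; last 2 first.
    exact: JPsi_int.
    exact: JPsiN_int.
  rewrite -(meanPsi n.+1 _ (Geta n.+1)) -(meanPsiN _ (Geta n.+1)).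
  (* Monotonicity of [J] exchanges [eta n.+1] for [etaN] in the cost. *)
  have [_] := J_monotone _ _ (PG_PGbar (Geta n.+1)) (PG_PGbar GN).
  rewrite !RintegralB//; try exact: J_int.
  by rewrite /g; lra.
have g_to0 : g n @[n --> \oo] --> 0.
  apply: (@cvg0_of_weighted_sum _ g (@harmonic R) (k ^+ 2 / K)
    ((C + beta 0%N * k) * (2 * M) + 2 * H + 2 * (k ^+ 2 / (2 * K))) 2) => //.
  - by move=> n; exact: harmonic_ge0.
  - exact: sum_harmonic_sqr_le2.
  - move=> N; apply: le_trans (ler_sum _ (fun n _ => g_regret n)) _.
    rewrite -Rintegral_sum//; apply: ae_le_mean; first exact: integrable_Rsum.
    apply: ae_imp player => i [x [xE y_eta _ [w wE Aw] Ai_le]].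
    rewrite /regret wE.
    exact: (player_regret K_gt0 h_strongly_convex omd beta0_gt0 betaE procedure
      A_convex xE y_eta N Ai_le h_le (Phi0_le i) Aw).
  - exact: dvg_harmonic.
have J_lsc : lower_semicontinuous (fun a : V => (J (a, etaN))%:E).
  exact: lsc_section (PG_PGbar GN) cond_ii.
apply: (cvg_law_of_cost A_bounded _ aPsi PsiE aPsiN PsiNE J_lsc) => //.
- by case: cond_i.
- exact: cond_v (PG_PGbar GN).
- by move=> n; exact: J_int.
- exact: J_int.
- by rewrite -cvg_shiftS; apply/subr_cvg0; exact: g_to0.
Qed.
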